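(* There exists a sufficiently large constant integer $M$ such that any algorithm that outputs a solution to \textsc{StrongSperner} with parameters $M$ and $d$ must make $2^{\Omega(d)}$ many queries to the labeling $\lambda$.
   Context: \textsc{StrongSperner}: Given integers $M,d$ and oracle access to a labeling $\lambda:[M]^d\to\{-1,+1\}^d$ (where $[M]=\{1,\dots,M\}$) satisfying, for every $i\in[d]$, the boundary conditions: $x_i=1\implies[\lambda(x)]_i=+1$ and $x_i=M\implies[\lambda(x)]_i=-1$. A solution is a tuple $x^{(1)},\dots,x^{(d)}\in[M]^d$ with $\max_{i,j\in[d]}\|x^{(i)}-x^{(j)}\|_\infty\le 1$ such that all labels are covered: for all $i\in[d]$ and $\ell\in\{-1,+1\}$ there exists $j\in[d]$ with $[\lambda(x^{(j)})]_i=\ell$. The lower bound refers to worst-case number of oracle queries to $\lambda$. *)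

(* Defs.v *)
From HB Require Import structures.
From mathcomp Require Import all_boot all_order all_algebra.
From mathcomp Require Import reals exp.

Set Implicit Arguments.
Unset Strict Implicit.
Unset Printing Implicit Defensive.

(* The grid [M]^d.  Coordinates are 0-based: the value k : 'I_M stands for
   k + 1, so that the two faces are k = 0 and k.+1 = M. *)
Definition point (M d : nat) := {ffun 'I_d -> 'I_M}.

(* {-1,+1}^d, where [true] encodes +1 and [false] encodes -1. *)
Definition label (d : nat) := {ffun 'I_d -> bool}.

Definition labeling (M d : nat) := {ffun point M d -> label d}.

Definition boundary_conditions (M d : nat) (lam : labeling M d) : bool :=
  [forall x : point M d, forall i : 'I_d,
     ((x i == 0 :> nat) ==> (lam x i == true)) &&
     (((x i).+1 == M) ==> (lam x i == false))].

Definition linf_dist (M d : nat) (x y : point M d) : nat :=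
  \max_(k < d) absz (Posz (x k) - Posz (y k))%R.

Definition is_solution (M d : nat) (lam : labeling M d)
    (s : d.-tuple (point M d)) : bool :=
  (\max_(i < d) \max_(j < d) linf_dist (tnth s i) (tnth s j) <= 1) &&
  [forall i : 'I_d, forall l : bool, exists j : 'I_d, lam (tnth s j) i == l].

(* Deterministic adaptive query algorithms, as decision trees: the next query,
   or the final output, depends only on the answers received so far.  There is
   no computational restriction.  Answers range over the finite type [label d],
   so each such tree has finite depth. *)
Inductive algorithm (M d : nat) : Type :=
| Output of d.-tuple (point M d)
| Query of point M d & (label d -> algorithm M d).

Fixpoint output (M d : nat) (A : algorithm M d) (lam : labeling M d) :
    d.-tuple (point M d) :=
  match A with
  | Output s => s
  | Query x next => output (next (lam x)) lam
  end.

Fixpoint num_queries (M d : nat) (A : algorithm M d) (lam : labeling M d) :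
    nat :=
  match A with
  | Output _ => 0
  | Query x next => (num_queries (next (lam x)) lam).+1
  end.

Definition solves_StrongSperner (M d : nat) (A : algorithm M d) : Prop :=
  forall lam : labeling M d,
    boundary_conditions lam -> is_solution lam (output A lam).

Definition worst_case_queries (M d : nat) (A : algorithm M d) : nat :=
  \max_(lam : labeling M d | boundary_conditions lam) num_queries A lam.

(* Main.v *)
Require Import Defs.
From HB Require Import structures.
From mathcomp Require Import all_boot all_order all_algebra.
From mathcomp Require Import reals exp.
From mathcomp Require Import zify.

(** The labels of distinct grid points are unrelated, so an adversary may choose
them online, as long as no cluster of nearby queried points sees both signs in
every coordinate.  Two coordinates (t, s) of the grid form a plane in which the
labels, read as directions, rotate clockwise; all other coordinates form two
blocks of n bits, encoded by the heights 0 and 10.  A path of words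
0 = w_0, w_1, w_2, ... is hidden as a helix winding around the plane: in the
upper half plane the first block stays at w_i while the second one moves from
w_i to w_(i+1), in the lower half plane the second block stays at w_(i+1) while
the first one catches up.  Near the helix the plane labels follow it
counterclockwise and the block labels point towards it.  Only the center of the
plane is singular for the default rotation; there the block labels point to
height 0, where the helix starts.  Hence every solution contains a point of the
upper half plane whose first block is the last word of the path.  Whenever such
a point is queried the adversary prolongs the path by a word not mentioned so
far, which it can do about 2^n / 2 times. *)

Set Implicit Arguments.
Unset Strict Implicit.
Unset Printing Implicit Defensive.

(** * Label fields of the plane *)

(* Imposes the boundary conditions for M = 19 on the label b of a coordinate of
   value t. *)
Definition force (b : bool) (t : nat) : bool :=
  if t == 0 then true else if t == 18 then false else b.

Definition cw (t s : nat) : bool * bool := (force (9 <= s) t, force (t < 14) s).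

(* Counterclockwise away from the segment [4, 14] x [8, 9], and equal to [cw]
   within distance 1 of it.  In between the direction turns by 180 degrees through
   the outward one; the thresholds keep opposite directions nonadjacent. *)
Definition spiral (t s : nat) : bool * bool :=
  let dt := (4 - t) + (t - 14) in
  let ds := (8 - s) + (s - 9) in
  let diag := (14 <= t) == (9 <= s) in
  (force ((s < 9) (+) ((dt < if diag then 4 else 2) && (ds < 3))) t,
   force ((14 <= t) (+) ((dt < 3) && (ds < if diag then 2 else 4))) s).

(* The first turn of the helix: everything flows to the upper left corner, so the
   center is not singular. *)
Definition start (t s : nat) : bool * bool :=
  if (9 <= s) && (t < 14) then spiral t s else (force false t, force true s).

Definition field (b : bool) := if b then start else spiral.

Definition constant_on_square (T : nat -> nat -> bool * bool) (a b : nat) : bool :=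
  let c := [:: T a b; T a b.+1; T a.+1 b; T a.+1 b.+1] in
  constant (unzip1 c) || constant (unzip2 c).

Lemma nat_forall (P : nat -> bool) m : all P (iota 0 m) -> forall i, i < m -> P i.
Proof. by move=> /allP h i im; apply: h; rewrite mem_iota. Qed.

Lemma nat_forall2 (P : nat -> nat -> bool) m :
  all (fun i => all (P i) (iota 0 m)) (iota 0 m) ->
  forall i j, i < m -> j < m -> P i j.
Proof. by move=> h i j im jm; apply: nat_forall jm; apply: nat_forall h _ im. Qed.

(** The four quadrants of the rotation meet only in the cell with corner (13, 8), its center; all
    cells are enumerated. *)
Lemma cw_constant a b : a < 18 -> b < 18 -> (a, b) != (13, 8) ->
  constant_on_square cw a b.
Proof.
move=> ha hb; apply/implyP.
by move: a b ha hb; apply: nat_forall2; vm_compute.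
Qed.

Lemma spiral_constant a b : a < 18 -> b < 18 -> (a, b) != (13, 8) ->
  constant_on_square spiral a b.
Proof.
move=> ha hb; apply/implyP.
by move: a b ha hb; apply: nat_forall2; vm_compute.
Qed.

(** Further left [field_transport] replaces the first turn by [spiral]. *)
Lemma start_constant a b : a < 18 -> b < 18 -> 12 <= a ->
  constant_on_square start a b.
Proof.
move=> ha hb; apply/implyP.
by move: a b ha hb; apply: nat_forall2; vm_compute.
Qed.

Lemma spiral_cw t s : 3 <= t <= 15 -> 7 <= s <= 10 -> spiral t s = cw t s.
Proof.
move=> ht hs; apply/eqP; move: hs; apply/implyP; move: ht; apply/implyP.
have [tM|] := ltnP t 18; last by lia.
have [sM|] := ltnP s 18; last by lia.
by move: t s tM sM; apply: nat_forall2; vm_compute.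
Qed.

Lemma start_cw t s : t < 14 -> s < 9 -> start t s = cw t s.
Proof.
by move=> ht hs; rewrite /start /cw ht leqNgt hs /=.
Qed.

Lemma start_spiral t s : t < 14 -> 9 <= s -> start t s = spiral t s.
Proof. by move=> ht hs; rewrite /start ht hs. Qed.

(** Keeps crossings between the half planes at the two ends, where [slide] is at rest. *)
Lemma field_neq_cw b t s : field b t s <> cw t s ->
  3 <= t <= 15 -> 7 <= s <= 10 -> b /\ 14 <= t.
Proof.
case: b => /= fN ht hs; last by case: fN; apply: spiral_cw.
have [t14|t14] := leqP 14 t; first by [].
case: fN; have [s9|s9] := ltnP s 9; first by rewrite start_cw.
by rewrite start_spiral // spiral_cw.
Qed.

(** * Words as heights, and the tube around the helix *)

Definition height (b : bool) : nat := if b then 10 else 0.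

(* Moves from the height of l at t <= 3 to the height of r at t >= 13, by at most
   one per step. *)
Definition slide (t : nat) (r l : bool) : nat :=
  if r == l then height r else
  if l then minn 10 (13 - t) else 10 - minn 10 (13 - t).

Lemma slide_right t r l : 13 <= t -> slide t r l = height r.
Proof. by case: r l => [] [] //=; rewrite /slide /height /=; lia. Qed.

Lemma slide_left t r l : t <= 3 -> slide t r l = height l.
Proof. by case: r l => [] [] //=; rewrite /slide /height /=; lia. Qed.

Lemma slide_le10 t r l : slide t r l <= 10.
Proof. by case: r l => [] [] //=; rewrite /slide /height /=; lia. Qed.

Lemma slide_close t t' r l : t <= t'.+1 -> t' <= t.+1 ->
  slide t r l <= (slide t' r l).+1.
Proof. by case: r l => [] [] //=; rewrite /slide /height /=; lia. Qed.

Section Labeling.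

Variable n : nat.

Definition word := n.-tuple bool.

Definition word0 : word := nseq_tuple n false.

Definition bit (u : word) (k : nat) : bool := nth false u k.

Lemma bit_word0 k : bit word0 k = false.
Proof. by rewrite /bit /= nth_nseq if_same. Qed.

Definition decode (m : nat) (f : nat -> nat) : word :=
  [tuple 6 <= f (m + k) | k < n].

Lemma decodeP m f (u : word) :
  (forall k, k < n -> height (bit u k) <= f (m + k) + 4 /\
                      f (m + k) <= height (bit u k) + 5) ->
  decode m f = u.
Proof.
move=> h; apply: eq_from_tnth => k; rewrite tnth_mktuple (tnth_nth false).
have := h k (ltn_ord k); rewrite -/(bit u k) /height.
by case: (bit u k) => -[]; lia.
Qed.

Definition top (f : nat -> nat) : bool := 9 <= f 1.

(** Reads the block that stands still in the half plane of [f], hence is legible all along the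
    tube. *)
Definition key (f : nat -> nat) : word :=
  if top f then decode 2 f else decode (2 + n) f.

(* Heights of the piece of the helix for the path edge e above the plane point
   (f 0, f 1). *)
Definition target (e : word * word) (f : nat -> nat) (j : nat) : nat :=
  if j < 2 + n then
    let k := j - 2 in
    if top f then height (bit e.1 k) else slide (f 0) (bit e.2 k) (bit e.1 k)
  else
    let k := j - (2 + n) in
    if top f then slide (f 0) (bit e.1 k) (bit e.2 k) else height (bit e.2 k).

Lemma target_le10 e f j : target e f j <= 10.
Proof.
have h b : height b <= 10 by case: b.
by rewrite /target; do 2! case: ifP => _; rewrite ?slide_le10 ?h.
Qed.

(** The margins are one less than those of [decodeP], so neighbours of a tube point decode to the
    same word. *)
Definition in_tube (e : word * word) (f : nat -> nat) : bool :=
  all (fun j => (target e f j <= f j + 3) && (f j <= target e f j + 4))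
      (iota 2 (n + n)).

Definition hole (f : nat -> nat) : bool := (4 <= f 0 <= 14) && (8 <= f 1 <= 9).

Variables (next prev : word -> option word).

(* In the lower half plane [prev word0 = Some word0] produces the constant piece
   on which the helix starts. *)
Definition edge (f : nat -> nat) : option (word * word) :=
  if top f then omap (fun v => (key f, v)) (next (key f))
  else omap (fun u => (u, key f)) (prev (key f)).

Definition plane_label (f : nat -> nat) : bool * bool :=
  if edge f is Some e then
    if in_tube e f then field (key f == word0) (f 0) (f 1) else cw (f 0) (f 1)
  else cw (f 0) (f 1).

Definition block_label (f : nat -> nat) (j : nat) : bool :=
  if edge f is Some e then
    if hole f then f j == 0 else f j <= target e f j
  else f j == 0.

Definition point_label (f : nat -> nat) (j : nat) : bool :=
  if j == 0 then (plane_label f).1 else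
  if j == 1 then (plane_label f).2 else block_label f j.

Definition end_point (f : nat -> nat) : bool :=
  [&& top f, next (key f) == None & prev (key f) != None].

Hypothesis next_prev : forall u v, next u = Some v -> v != word0 /\ prev v = Some u.
Hypothesis prev_next : forall u v, prev v = Some u -> v != word0 -> next u = Some v.
Hypothesis next_path : forall u, next u != None -> prev u != None.
Hypothesis prev0 : prev word0 = Some word0.

(** * Transport between neighbouring points *)

Definition close (f g : nat -> nat) : Prop :=
  forall j, f j <= (g j).+1 /\ g j <= (f j).+1.

Lemma in_tubeP e f : reflect
  (forall j, 2 <= j < 2 + (n + n) -> target e f j <= f j + 3 /\ f j <= target e f j + 4)
  (in_tube e f).
Proof.
apply: (iffP allP) => h j.
  by move=> hj; apply/andP/h; rewrite mem_iota.
by rewrite mem_iota => /h [-> ->].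
Qed.

Lemma decode_close1 e f g u : in_tube e f -> close f g ->
  (forall k, k < n -> target e f (2 + k) = height (bit u k)) -> decode 2 g = u.
Proof.
move=> /in_tubeP ft fg hu; apply: decodeP => k kn.
have := ft (2 + k) ltac:(lia); rewrite hu //.
by have := fg (2 + k); lia.
Qed.

Lemma decode_close2 e f g u : in_tube e f -> close f g ->
  (forall k, k < n -> target e f (2 + n + k) = height (bit u k)) ->
  decode (2 + n) g = u.
Proof.
move=> /in_tubeP ft fg hu; apply: decodeP => k kn.
have := ft (2 + n + k) ltac:(lia); rewrite hu //.
by have := fg (2 + n + k); lia.
Qed.

Lemma target_right e f j : edge f = Some e -> 13 <= f 0 ->
  target e f j =
  height (bit (key f) (if j < 2 + n then j - 2 else j - (2 + n))).
Proof.
move=> + f13; rewrite /edge /target.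
case: (top f).
  case: (next _) => //= v [<-] /=.
  by case: ifP => // _; rewrite slide_right.
case: (prev _) => //= u [<-] /=.
by case: ifP => // _; rewrite slide_right.
Qed.

Lemma target_left e f j : f 0 <= 3 ->
  target e f j =
  height (if j < 2 + n then bit e.1 (j - 2) else bit e.2 (j - (2 + n))).
Proof.
by move=> f3; rewrite /target; do 2! case: ifP => // _; rewrite slide_left.
Qed.

Lemma target_same e f g j : close f g -> top f = top g ->
  target e f j <= (target e g j).+1.
Proof.
move=> fg eqt; rewrite /target -eqt.
by do 2! case: ifP => // _; apply: slide_close; have := fg 0; lia.
Qed.

Lemma key_same e f g : edge f = Some e -> in_tube e f -> close f g ->
  top f = top g -> key g = key f.
Proof.
rewrite /edge /key => fe ft fg eqt; rewrite -eqt; move: fe.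
case: ifP => topf.
  case: (next _) => //= v [def_e]; apply: decode_close1 ft fg _ => k kn.
  by rewrite /target -def_e topf /= addKn ifT //; lia.
case: (prev _) => //= u [def_e]; apply: decode_close2 ft fg _ => k kn.
by rewrite /target -def_e topf /= addKn ifF //; lia.
Qed.

Lemma key_right e f g : edge f = Some e -> in_tube e f -> close f g ->
  13 <= f 0 -> key g = key f.
Proof.
move=> fe ft fg f13; rewrite {1}/key; case: ifP => _.
  apply: decode_close1 ft fg _ => k kn.
  by rewrite (target_right _ fe) // addKn ifT //; lia.
apply: decode_close2 ft fg _ => k kn.
by rewrite (target_right _ fe) // addKn ifF //; lia.
Qed.

Lemma edge_key f e : edge f = Some e ->
  if top f then e.1 = key f /\ next (key f) = Some e.2
  else e.2 = key f /\ prev (key f) = Some e.1.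
Proof.
rewrite /edge; case: (top f).
  by case: (next _) => //= w [<-].
by case: (prev _) => //= w [<-].
Qed.

(** Neighbours in one half plane share their edge. At the right end both blocks show the same word,
    and crossing leads to the adjacent edge of the path; at the left end they show [e.1] and [e.2],
    and crossing keeps the edge. *)
Lemma edge_transport e f g :
  edge f = Some e -> in_tube e f -> close f g ->
  field (key f == word0) (f 0) (f 1) <> cw (f 0) (f 1) ->
  ~~ end_point g ->
  exists e', [/\ edge g = Some e',
    forall j, target e f j <= (target e' g j).+1 /\
              target e' g j <= (target e f j).+1,
    13 <= f 0 -> key g = key f &
    f 0 < 13 -> ~~ top g -> key g != word0].
Proof.
move=> fe ft fg fN gE.
have gf : close g f by move=> j; have [] := fg j.
have [eqt|neqt] := eqVneq (top f) (top g).
  exists e; have eqk := key_same fe ft fg eqt; split=> //.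
  - by rewrite /edge -eqt eqk -/(edge f).
  - by move=> j; split; apply: target_same.
  - rewrite -eqt eqk => f13 fbot; apply/eqP => k0; apply: fN.
    by rewrite k0 eqxx /= start_cw //; move: fbot; rewrite /top; lia.
have f89 : 8 <= f 1 <= 9.
  by move: neqt; rewrite /top; have := fg 1; case: (leqP 9 (f 1)); lia.
have [f13|f13] := leqP 13 (f 0).
  have f16 : 14 <= f 0.
    have [|f15] := leqP 16 (f 0); first by lia.
    by have [] := field_neq_cw fN ltac:(lia) ltac:(lia).
  have g13 : 13 <= g 0 by have := fg 0; lia.
  have eqk := key_right fe ft fg f13.
  have [e' ge] : exists e', edge g = Some e'.
    have := edge_key fe; move: neqt gE; rewrite /edge /end_point eqk.
    case: (top f); case: (top g) => //= _.
      move=> _ [_ nk]; have : next (key f) != None by rewrite nk.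
      by move/next_path; case: (prev _) => // w _; eexists.
    by move=> + [_ pk]; rewrite pk andbT; case: (next _) => // w _; eexists.
  exists e'; split=> // j.
  by rewrite (target_right _ fe) // (target_right _ ge) // eqk.
have f2 : f 0 <= 2.
  rewrite leqNgt; apply/negP => f3.
  by have [] := field_neq_cw fN ltac:(lia) ltac:(lia); lia.
have g3 : g 0 <= 3 by have := fg 0; lia.
have kg : key g = if top f then e.2 else e.1.
  rewrite /key; move: neqt; case: (top f); case: (top g) => // _.
    apply: decode_close2 ft fg _ => k kn.
    by rewrite target_left ?addKn ?ifF //; lia.
  apply: decode_close1 ft fg _ => k kn.
  by rewrite target_left ?addKn ?ifT //; lia.
have [ge kN] : edge g = Some e /\ (~~ top g -> key g != word0).
  have := edge_key fe; move: neqt kg; rewrite /edge.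
  case topf: (top f); case: (top g) => //= _ -> [e1 nk].
    have [eN pe] := next_prev nk; split=> //.
    by rewrite pe /= -e1; case: (e).
  (* The constant piece below [word0] does not continue on the left, but there the first turn equals
     [cw], against [fN]. *)
  have k0 : key f != word0.
    apply/eqP => k0; apply: fN; rewrite k0 eqxx /= start_cw //; first by lia.
    by move: topf; rewrite /top; lia.
  by have -> := prev_next nk k0; split=> //=; rewrite -e1; case: (e).
exists e; split=> // j.
by rewrite !target_left //; lia.
Qed.

(** [start] and [spiral] agree in the upper left quadrant, so a first turn met left of 13 may be
    read as [spiral]. *)
Lemma field_transport e f g :
  edge f = Some e -> in_tube e f -> close f g ->
  field (key f == word0) (f 0) (f 1) <> cw (f 0) (f 1) ->
  ~~ end_point g ->
  field (key g == word0) (g 0) (g 1) =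
  field ((key f == word0) && (13 <= f 0)) (g 0) (g 1).
Proof.
move=> fe ft fg fN gE.
have [e' [_ _ eqk kN]] := edge_transport fe ft fg fN gE.
have [f13|f13] := leqP 13 (f 0); first by rewrite andbT eqk.
rewrite andbF; have [topg|botg] := boolP (top g); last first.
  by rewrite (negPf (kN f13 botg)).
case: eqP => //= _; rewrite start_spiral //.
by have := fg 0; lia.
Qed.

Lemma block_label_transport e f g e' j :
  edge f = Some e -> in_tube e f -> close f g ->
  field (key f == word0) (f 0) (f 1) <> cw (f 0) (f 1) ->
  ~~ end_point g -> edge g = Some e' ->
  block_label g j = (g j <= target e' g j).
Proof.
move=> fe ft fg fN gE ge; rewrite /block_label ge; case: ifP => // hg.
have [_ [_ _ eqk _]] := edge_transport fe ft fg fN gE.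
have [] := field_neq_cw fN;
  try by have := fg 0; have := fg 1; move: hg; rewrite /hole; lia.
move=> /eqP k0 f14; rewrite (target_right _ ge); last by have := fg 0; lia.
by rewrite eqk ?k0 ?bit_word0 ?leqn0 //; lia.
Qed.

Definition on_spiral (f : nat -> nat) : bool :=
  if edge f is Some e then
    in_tube e f && (field (key f == word0) (f 0) (f 1) != cw (f 0) (f 1))
  else false.

Lemma plane_label_cw f : ~~ on_spiral f -> plane_label f = cw (f 0) (f 1).
Proof.
rewrite /on_spiral /plane_label; case: (edge f) => // e.
by case: (in_tube e f) => //=; rewrite negbK => /eqP.
Qed.

(** * Clusters without end points miss a label *)

Section Cluster.

Variables (I : finType) (F : I -> nat -> nat) (i0 : I).
Hypothesis F_le18 : forall i j, F i j <= 18.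
Hypothesis F_close : forall i i', close (F i) (F i').
Hypothesis F_end : forall i, ~~ end_point (F i).

Definition uncovered : Prop :=
  exists j, j < 2 + (n + n) /\ exists l, forall i, point_label (F i) j = l.

Lemma cluster_base j : exists2 a, a < 18 & forall i, a <= F i j <= a.+1.
Proof.
have [i _ imin] := arg_minnP (fun i => F i j) (erefl : xpredT i0).
(* The cap at 17 keeps the cell inside the grid. *)
exists (minn (F i j) 17); first by lia.
by move=> i'; have := imin i' isT; have := F_close i i' j; have := F_le18 i' j; lia.
Qed.

Lemma constant4P (T : eqType) (w x y z : T) :
  constant [:: w; x; y; z] -> [/\ x = w, y = w & z = w].
Proof. by move=> /= /and4P[/eqP-> /eqP-> /eqP->]. Qed.

Lemma uncovered_plane (T : nat -> nat -> bool * bool) a b :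
  (forall i, a <= F i 0 <= a.+1) -> (forall i, b <= F i 1 <= b.+1) ->
  (forall i, plane_label (F i) = T (F i 0) (F i 1)) ->
  constant_on_square T a b -> uncovered.
Proof.
move=> Fa Fb FT /orP[] /constant4P[h1 h2 h3].
  exists 0; split=> //; exists (T a b).1 => i; rewrite /point_label /= FT.
  have [->|->] : F i 0 = a \/ F i 0 = a.+1 by have := Fa i; lia.
    by have [->|->] : F i 1 = b \/ F i 1 = b.+1 by have := Fb i; lia.
  by have [->|->] : F i 1 = b \/ F i 1 = b.+1 by have := Fb i; lia.
exists 1; split=> //; exists (T a b).2 => i; rewrite /point_label /= FT.
have [->|->] : F i 0 = a \/ F i 0 = a.+1 by have := Fa i; lia.
  by have [->|->] : F i 1 = b \/ F i 1 = b.+1 by have := Fb i; lia.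
by have [->|->] : F i 1 = b \/ F i 1 = b.+1 by have := Fb i; lia.
Qed.

Lemma point_label_block f j : 1 < j -> point_label f j = block_label f j.
Proof. by case: j => [|[]]. Qed.

(** If all points are in the tube, a single field labels the plane. Otherwise some height deviates
    from its target by at least 4, which outweighs the variation of heights (1) and targets (2): all
    points lie on the same side of their targets. *)
Lemma uncovered_on_spiral i : on_spiral (F i) -> uncovered.
Proof.
rewrite /on_spiral; case fe: (edge (F i)) => [e|] // /andP[ft /eqP fN].
have tr i' := edge_transport fe ft (F_close i i') fN (F_end i').
have [/forallP allcore|] := boolP
  [forall i', if edge (F i') is Some e' then in_tube e' (F i') else true].
  have [a aM Fa] := cluster_base 0; have [b bM Fb] := cluster_base 1.
  set B := (key (F i) == word0) && (13 <= F i 0).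
  apply: (@uncovered_plane (field B) a b) => //.
    move=> i'; rewrite -(field_transport fe ft (F_close i i') fN (F_end i')).
    have [e' [ge _ _ _]] := tr i'; have := allcore i'.
    by rewrite /plane_label ge => ->.
  have := Fa i; have := Fb i => hb ha.
  case defB: B => /=.
    apply: start_constant => //; move: defB; rewrite /B; lia.
  apply: spiral_constant => //; apply/eqP => -[a13 b8].
  (* In the central cell only the first turn departs from [cw], and then [B] is true. *)
  have [k0 f14] := field_neq_cw fN ltac:(lia) ltac:(lia).
  by move: defB; rewrite /B k0; lia.
rewrite negb_forall => /existsP[i1].
have [e1 [ge1 t1 _ _]] := tr i1; rewrite ge1 => /allPn[j].
rewrite mem_iota => hj; rewrite negb_and -!ltnNge => hD.
exists j; split; first by lia.
exists (F i1 j < target e1 (F i1) j) => i2.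
have [e2 [ge2 t2 _ _]] := tr i2.
rewrite point_label_block; last by lia.
rewrite (block_label_transport _ fe ft (F_close i i2) fN (F_end i2) ge2).
have := t1 j; have := t2 j; have := F_close i1 i2 j.
by case/orP: hD; lia.
Qed.

(** Off the spiral only the central cell is critical. A height above 1 there makes a block label
    negative throughout; if there is none, the points lie in the tube at the start of the helix,
    where [start] points up. *)
Lemma cluster_uncovered : uncovered.
Proof.
have [/existsP[i]|] := boolP [exists i, on_spiral (F i)].
  exact: uncovered_on_spiral.
rewrite negb_exists => /forallP off.
have [a aM Fa] := cluster_base 0; have [b bM Fb] := cluster_base 1.
have [|abN] := eqVneq (a, b) (13, 8); last first.
  apply: (@uncovered_plane cw a b) => //; last exact: cw_constant.
  by move=> i; apply: plane_label_cw.
case=> a13 b8; subst a b.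
have Fh i : hole (F i) by have := Fa i; have := Fb i; rewrite /hole; lia.
have blk i j : block_label (F i) j = (F i j == 0).
  by rewrite /block_label Fh; case: (edge _).
have [/existsP[i /hasP[j]]|] :=
    boolP [exists i, has (fun j => 1 < F i j) (iota 2 (n + n))].
  rewrite mem_iota => hj Fj; exists j; split; first by lia.
  exists false => i'; rewrite point_label_block ?blk; last by lia.
  by have := F_close i i' j; lia.
rewrite negb_exists => /forallP small.
have {}small i j : 2 <= j < 2 + (n + n) -> F i j <= 1.
  move=> hj; rewrite leqNgt; apply/negP => Fj.
  by have /hasP[] := small i; exists j => //; rewrite mem_iota.
exists 1; split=> //; exists true => i; rewrite /point_label /=.
have k0 : key (F i) = word0.
  rewrite /key; case: ifP => _; apply: decodeP => k kn;
    rewrite bit_word0 /=; split=> //;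
    by apply: leq_trans (small i _ _) _; lia.
have [e ge] : exists e, edge (F i) = Some e.
  have := F_end i; rewrite /end_point /edge k0 prev0 /= andbT.
  by case: (top _) => /=; [case: (next _) => //= w _; eexists|eexists].
have Ft : in_tube e (F i).
  apply/in_tubeP => j hj.
  rewrite (target_right _ ge) ?k0 ?bit_word0 /=; last by have := Fa i; lia.
  by have := small i j hj; lia.
rewrite /plane_label ge Ft k0 eqxx /=.
have [->|->] : F i 0 = 13 \/ F i 0 = 14 by have := Fa i; lia.
  by have [->|->] : F i 1 = 8 \/ F i 1 = 9 by have := Fb i; lia.
by have [->|->] : F i 1 = 8 \/ F i 1 = 9 by have := Fb i; lia.
Qed.

End Cluster.
End Labeling.

(** * Paths of words *)

Section Path.

Variable n : nat.
Implicit Types (p q t U : seq (word n)) (u v : word n) (f : nat -> nat).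
Local Notation word0 := (word0 n).

Definition path_next p u : option (word n) :=
  if (index u p).+1 < size p then Some (nth word0 p (index u p).+1) else None.

(** As [0.-1 = 0], the first word is its own predecessor, as [prev0] demands. *)
Definition path_prev p u : option (word n) :=
  if u \in p then Some (nth word0 p (index u p).-1) else None.

Lemma path_next_prev q : uniq (word0 :: q) -> forall u v,
  path_next (word0 :: q) u = Some v ->
  v != word0 /\ path_prev (word0 :: q) v = Some u.
Proof.
move: (word0 :: q) (index_head word0 q) => p p0 pU u v.
rewrite /path_next; case: ifP => // iu [<-].
have iv : index (nth word0 p (index u p).+1) p = (index u p).+1.
  exact: index_uniq.
split; first by apply: contra_eq_neq iv => ->; rewrite p0.
rewrite /path_prev mem_nth // iv succnK nth_index //.
by rewrite -index_mem; apply: ltn_trans iu.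
Qed.

Lemma path_prev_next q : uniq (word0 :: q) -> forall u v,
  path_prev (word0 :: q) v = Some u -> v != word0 ->
  path_next (word0 :: q) u = Some v.
Proof.
move=> pU u v; rewrite /path_prev; case: ifP => // vp uE v0; move: vp uE.
have : 0 < index v (word0 :: q) by rewrite /= eq_sym (negPf v0).
move: (word0 :: q) pU => p pU iv vp [<-].
have ip : index v p < size p by rewrite index_mem.
have iu : index (nth word0 p (index v p).-1) p = (index v p).-1.
  by apply: index_uniq => //; apply: leq_ltn_trans ip; apply: leq_pred.
by rewrite /path_next iu prednK // ip nth_index.
Qed.

Lemma path_next_mem p u : path_next p u != None -> path_prev p u != None.
Proof.
rewrite /path_next /path_prev -index_mem; case: ifP => // /ltnW iu _.
by rewrite iu.
Qed.

Lemma path_prev0 q : path_prev (word0 :: q) word0 = Some word0.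
Proof. by rewrite /path_prev mem_head /= eqxx. Qed.

(** The loose end of the path, where prolonging it may change labels. *)
Definition exposed p f : bool := top f && (key n f == last word0 p).

Lemma end_point_exposed p f :
  end_point (path_next p) (path_prev p) f -> exposed p f.
Proof.
rewrite /end_point /exposed => /and3P[-> /= + +].
rewrite /path_next /path_prev -index_mem.
case: ltnP => // isz _; case: ifP => // ilt _.
have szp : size p = (index (key n f) p).+1 by apply/eqP; rewrite eqn_leq isz.
rewrite -nth_last szp /=.
by rewrite nth_index // -index_mem.
Qed.

Definition path_label p := point_label (path_next p) (path_prev p).

Lemma eq_point_label (next prev next' prev' : word n -> option (word n)) f :
  edge next prev f = edge next' prev' f ->
  point_label next prev f =1 point_label next' prev' f.
Proof. by move=> e j; rewrite /point_label /plane_label /block_label e. Qed.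

Lemma path_label_cat p t f : key n f \notin t -> ~~ exposed p f ->
  path_label (p ++ t) f =1 path_label p f.
Proof.
rewrite /exposed => kt expo; apply: eq_point_label; rewrite /edge.
move: expo; case: (top f) => [/= kl|_]; last first.
  congr omap; rewrite /path_prev mem_cat (negPf kt) orbF.
  case: ifP => // kp; rewrite index_cat kp nth_cat ifT //.
  by rewrite (leq_ltn_trans (leq_pred _)) // index_mem.
congr omap; rewrite /path_next index_cat size_cat.
have [kp|kp] := boolP (key n f \in p); last first.
  by rewrite (memNindex kp) (memNindex kt) -addnS !ltnNge leq_add2l !leqnSn.
have ilt : (index (key n f) p).+1 < size p.
  move: (kp); rewrite -index_mem => ilt; rewrite ltn_neqAle ilt andbT.
  apply: contraNneq kl => isz; rewrite -nth_last -isz /= nth_index //.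
by rewrite ilt nth_cat ilt (ltn_addr _ ilt).
Qed.

(** * States of the adversary *)

Lemma fresh_word U : size U < 2 ^ n -> exists v, v \notin U.
Proof.
move=> sU; apply/existsP; apply: contraTT sU.
rewrite negb_exists => /forallP allU; rewrite -leqNgt.
have <- : #|{: word n}| = 2 ^ n by rewrite card_tuple card_bool.
apply: leq_trans (card_size U); apply/subset_leq_card/subsetP => v _.
by have := allU v; rewrite negbK.
Qed.

(* [p]: the part of the hidden path already committed to; [U]: the words that
   may no longer be used to prolong it. *)
Definition state p U : Prop :=
  [/\ exists q, p = word0 :: q, uniq p & {subset p <= U}].

Definition later p U p' U' : Prop :=
  [/\ exists2 t, p' = p ++ t & {in t, forall v, v \notin U}, {subset U <= U'}
    & state p' U'].

Lemma later_refl p U : state p U -> later p U p U.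
Proof. by move=> pU; split=> //; exists [::]; rewrite ?cats0. Qed.

Lemma later_trans p U p1 U1 p2 U2 :
  later p U p1 U1 -> later p1 U1 p2 U2 -> later p U p2 U2.
Proof.
move=> [[t -> tU] UU1 _] [[t1 -> tU1] UU2 st]; split=> //.
  exists (t ++ t1); first by rewrite catA.
  move=> v; rewrite mem_cat => /orP[/tU //|/tU1].
  exact/contra/UU1.
by move=> v /UU1/UU2.
Qed.

(** Prolongations avoid [U], so the label of such a point is final. *)
Definition settled p U f : bool := (key n f \in U) && ~~ exposed p f.

Lemma settled_notin p U f t : settled p U f -> {in t, forall v, v \notin U} ->
  key n f \notin t.
Proof. by move=> /andP[kU _] tU; apply/negP => /tU; rewrite kU. Qed.

Lemma settled_later p U p' U' f :
  later p U p' U' -> settled p U f -> settled p' U' f.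
Proof.
move=> [[t -> tU] UU' _] sf; have kt := settled_notin sf tU.
case/andP: sf => kU /= expo; rewrite /settled UU' //= /exposed last_cat.
case: t kt {tU} => [|v t] kt //=; rewrite negb_and; apply/orP; right.
by apply: contraNneq kt => ->; apply: mem_last.
Qed.

Lemma path_label_later p U p' U' f :
  later p U p' U' -> settled p U f -> path_label p' f =1 path_label p f.
Proof.
move=> [[t -> tU] _ _] sf; have kt := settled_notin sf tU.
by case/andP: sf => _; apply: path_label_cat.
Qed.

(** The key is spent so that the path never comes to it later; an exposed point costs one more word,
    which prolongs the path. *)
Lemma settle p U f : state p U -> size U + 2 <= 2 ^ n ->
  exists p' U', [/\ later p U p' U', size U' <= size U + 2 & settled p' U' f].
Proof.
move=> st sU; have [[q def_p] p_uniq pU] := st.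
have [ex|nex] := boolP (exposed p f); last first.
  exists p, (key n f :: U); split=> /=; first last.
  - by rewrite /settled mem_head.
  - by lia.
  split; first by exists [::]; rewrite ?cats0.
    by move=> v vU; rewrite inE vU orbT.
  by split=> // [|v /pU vU]; [exists q|rewrite inE vU orbT].
have [v] : exists v, v \notin key n f :: U by apply: fresh_word => /=; lia.
rewrite inE negb_or => /andP[vk vU].
exists (p ++ [:: v]), (v :: key n f :: U); split=> /=; first last.
- by rewrite /settled /exposed last_cat !inE eqxx orbT eq_sym (negPf vk) andbF.
- by lia.
split.
- by exists [:: v] => // w; rewrite inE => /eqP->.
- by move=> w wU; rewrite !inE wU !orbT.
split.
- by exists (q ++ [:: v]); rewrite def_p.
- rewrite cats1 rcons_uniq p_uniq andbT; apply: contra vU; exact: pU.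
- move=> w; rewrite mem_cat !inE => /orP[/pU ->|->] //; by rewrite !orbT.
Qed.

Lemma settle_all (T : Type) (F : T -> nat -> nat) (s : seq T) p U :
  state p U -> size U + 2 * size s <= 2 ^ n ->
  exists p' U', later p U p' U' /\ all (fun x => settled p' U' (F x)) s.
Proof.
elim: s p U => [|x s IHs] p U st /= sU.
  by exists p, U; split=> //; apply: later_refl.
have [|p1 [U1 [l1 sU1 x1]]] := @settle p U (F x) st; first by lia.
have st1 : state p1 U1 by case: l1.
have [|p2 [U2 [l2 s2]]] := IHs p1 U1 st1; first by lia.
exists p2, U2; split; first exact: later_trans l1 l2.
by rewrite (settled_later l2 x1).
Qed.

(** * Labelings of the grid and the query bound *)

Variable d : nat.
Hypothesis nd : 2 + (n + n) <= d.

(** The default 0 lets [close] hold at indices beyond [d] too. *)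
Definition coord (x : point 19 d) (j : nat) : nat :=
  if insub j is Some i then x i : nat else 0.

Lemma coord_ord (x : point 19 d) (i : 'I_d) : coord x i = x i.
Proof. by rewrite /coord valK. Qed.

Lemma coord_le18 (x : point 19 d) j : coord x j <= 18.
Proof. by rewrite /coord; case: insub => // i; rewrite -ltnS. Qed.

Definition path_labeling p : labeling 19 d :=
  [ffun x => [ffun i : 'I_d => path_label p (coord x) i]].

Lemma force_boundary b (m : nat) :
  ((m == 0) ==> (force b m == true)) && ((m.+1 == 19) ==> (force b m == false)).
Proof. by rewrite /force eqSS; case: (m =P 0) => [->|_] //=; case: eqP. Qed.

Lemma plane_label_force next prev f : exists b c,
  @plane_label n next prev f = (force b (f 0), force c (f 1)).
Proof.
have field_force k : exists b c,
    field k (f 0) (f 1) = (force b (f 0), force c (f 1)).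
  by case: k => /=; rewrite /start /spiral; try case: ifP; do 2! eexists.
have cw_force : exists b c, cw (f 0) (f 1) = (force b (f 0), force c (f 1)).
  by do 2! eexists.
by rewrite /plane_label; case: (edge _ _ _) => // e; case: ifP.
Qed.

Lemma path_labeling_boundary p : boundary_conditions (path_labeling p).
Proof.
apply/forallP => x; apply/forallP => i; rewrite !ffunE -coord_ord.
set j : nat := i; rewrite /path_label /point_label.
have [b [c ->]] := plane_label_force (path_next p) (path_prev p) (coord x).
have [j0|_] := eqVneq j 0; first rewrite j0 /=.
  exact: force_boundary.
have [j1|_] := eqVneq j 1; first rewrite j1 /=.
  exact: force_boundary.
rewrite /block_label; case: (edge _ _ _) => [e|]; last first.
  by case: (coord x j) => //= k; rewrite implybT.
case: ifP => _; first by case: (coord x j) => //= k; rewrite implybT.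
by have := target_le10 e (coord x) j; lia.
Qed.

Lemma linf_dist_coord (x y : point 19 d) j : linf_dist x y <= 1 ->
  coord x j <= (coord y j).+1 /\ coord y j <= (coord x j).+1.
Proof.
move=> xy; rewrite /coord; case: insubP => // i _ _.
by have := leq_trans (leq_bigmax i) xy; lia.
Qed.

Lemma solution_exposed p (s : d.-tuple (point 19 d)) :
  (exists q, p = word0 :: q) -> uniq p ->
  is_solution (path_labeling p) s -> exists i, exposed p (coord (tnth s i)).
Proof.
move=> [q def_p] p_uniq /andP[close_s /forallP cover].
apply/existsP; apply: contraT; rewrite negb_exists => /forallP nex.
have d_gt0 : 0 < d by lia.
have [j [jd [l lab]]] : uncovered (path_next p) (path_prev p)
    (fun i : 'I_d => coord (tnth s i)).
  apply: cluster_uncovered (Ordinal d_gt0) _ _ _.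
  - by move: p_uniq; rewrite def_p; apply: path_next_prev.
  - by move: p_uniq; rewrite def_p; apply: path_prev_next.
  - exact: path_next_mem.
  - by rewrite def_p path_prev0.
  - by move=> i j; apply: coord_le18.
  - move=> i i' j; apply: linf_dist_coord.
    apply: leq_trans close_s; apply: leq_trans (leq_bigmax i).
    exact: (leq_bigmax i').
  - by move=> i; apply: contra (nex i); apply: end_point_exposed.
have jd' : j < d by exact: leq_trans nd.
have /forallP/(_ (~~ l))/existsP[i] := cover (Ordinal jd').
by rewrite !ffunE /path_label lab; case: (l).
Qed.

Lemma settled_path_labeling p U p' U' x :
  later p U p' U' -> settled p U (coord x) ->
  path_labeling p' x = path_labeling p x.
Proof.
by move=> lpp sx; apply/ffunP => i; rewrite !ffunE (path_label_later lpp sx).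
Qed.

(** Each query and each of the [d] output points costs at most two words. While words last, every
    output point gets settled, so none is exposed and [solution_exposed] refutes the output. *)
Lemma adversary (A : algorithm 19 d) p U : state p U ->
  exists p' U', later p U p' U' /\
    (2 ^ n < size U + 2 * (num_queries A (path_labeling p') + d) \/
     ~~ is_solution (path_labeling p') (output A (path_labeling p'))).
Proof.
elim: A p U => [s|x next IH] p U st.
  have [sU|sU] := ltnP (2 ^ n) (size U + 2 * d).
    by exists p, U; split; [apply: later_refl|left].
  have [|p' [U' [l' /allP s']]] := @settle_all _ coord s p U st.
    by rewrite size_tuple.
  exists p', U'; split=> //; right; apply/negP => /= sol.
  have [_ _ [p0 p_uniq _]] := l'.
  have [i] := solution_exposed p0 p_uniq sol.
  by have /andP[_ /negPf->] := s' _ (mem_tnth i s).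
have [sU|sU] := ltnP (2 ^ n) (size U + 2).
  exists p, U; split; first exact: later_refl.
  by left; apply: leq_trans sU _; rewrite leq_add2l /= addSn mulnS leq_addr.
have [p1 [U1 [l1 sU1 s1]]] := settle (coord x) st sU.
have st1 : state p1 U1 by case: l1.
have [p2 [U2 [l2 win]]] := IH (path_labeling p1 x) p1 U1 st1.
exists p2, U2; split; first exact: later_trans l1 l2.
rewrite /= (settled_path_labeling l2 s1).
case: win => win; [left|by right].
by apply: leq_trans win _; rewrite addSn mulnS addnA leq_add2r.
Qed.

Lemma query_bound (A : algorithm 19 d) : solves_StrongSperner A ->
  2 ^ n <= 2 * (worst_case_queries A + d).
Proof.
move=> solA; have st : state [:: word0] [:: word0].
  by split=> //; exists [::].
have [p [U [_ []]]] := adversary A st; last first.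
  by rewrite solA // path_labeling_boundary.
rewrite /= add1n ltnS => /leq_trans; apply.
rewrite leq_mul2l leq_add2r /=.
rewrite /worst_case_queries.
exact/leq_bigmax_cond/path_labeling_boundary.
Qed.

End Path.

(** * Asymptotics *)

Lemma exp_dominates a : 10 <= a -> 2 ^ a.+2 + 16 * a + 32 <= 2 ^ (a + a).-1.
Proof.
move=> a10; have h : 16 * a + 32 <= 2 ^ a.+2.
  have -> : a = (a - 10) + 10 by lia.
  elim: (a - 10) => [//|k]; rewrite (expnS 2 (k + 10).+2).
  by move: (2 ^ _) => e; lia.
have -> : (a + a).-1 = a.+2 + (a - 3) by lia.
rewrite expnD; have : 2 ^ 1 <= 2 ^ (a - 3) by apply: leq_pexp2l => //; lia.
rewrite expn1 => h2; have := leq_mul (leqnn (2 ^ a.+2)) h2; lia.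
Qed.

Import Order.TTheory GRing.Theory Num.Theory.
Local Open Scope ring_scope.

(* The condition 1 < M excludes the degenerate sizes for which there is no
   algorithm (M = 0) or the boundary conditions are contradictory (M = 1). *)
Theorem mainTheorem2 (R : realType) :
  exists M : nat, (1 < M)%N /\
  exists c : R, 0 < c /\
  exists d0 : nat, forall d : nat, (d0 <= d)%N ->
  forall A : algorithm M d, solves_StrongSperner A ->
    2%:R `^ (c * d%:R) <= (worst_case_queries A)%:R.
Proof.
(* The rate 1/4 suits the bound [2 ^ a.+1] below, as [d <= 4 * a.+1] for [a = d %/ 4]. *)
exists 19%N; split=> //; exists (4%:R^-1); split; first by rewrite invr_gt0 ltr0n.
exists 44%N => d d44 A solA.
set a := (d %/ 4)%N.
have hd : (d < 4 * a + 4)%N by rewrite /a; lia.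
have ha : (4 * a <= d)%N by rewrite /a; lia.
(* Blocks of [(a + a).-1] bits and the plane fill [4 * a] coordinates. *)
have nd : (2 + ((a + a).-1 + (a + a).-1) <= d)%N by lia.
have bound := query_bound nd solA.
have dom : (2 ^ a.+2 + 16 * a + 32 <= 2 ^ (a + a).-1)%N.
  by apply: exp_dominates; lia.
have qb : (2 ^ a.+1 <= worst_case_queries A)%N.
  by move: dom bound; rewrite (expnS 2 a.+1); lia.
apply: (@le_trans _ _ ((2 ^ a.+1)%N%:R)); last by rewrite ler_nat.
rewrite natrX -powR_mulrn ?ler0n //; apply: ler_powR; first by rewrite ler1n.
rewrite mulrC ler_pdivrMr ?ltr0n // -natrM ler_nat; lia.
Qed.
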